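(* Let $M$ be a matroid on $X=\{t_1,\ldots,t_s\}$, let $\mathcal{C}_M$ be its set of circuits, and let $S=K[t_1,\ldots,t_s]$ be a polynomial ring over a field $K$. If $I=(t_e \mid e\in\mathcal{C}_M)\subset S$ is the ideal of circuits of $M$, where $t_e=\prod_{t_i\in e}t_i$, then $$\mathrm{v}(I)\leq\mathrm{reg}(S/I).$$
   Context: A circuit of a matroid is a minimal dependent set. With the standard grading $S=\bigoplus_{d\ge0}S_d$, for a proper squarefree monomial ideal $I\subset S$ the v-number is $\mathrm{v}(I)=\min\{d\geq 0\mid \exists f\in S_d\text{ and }\mathfrak{p}\in\mathrm{Ass}(I)\text{ with }(I\colon f)=\mathfrak{p}\}$, where $\mathrm{Ass}(I)$ is the set of associated primes of $S/I$ and $(I\colon f)=\{g\in S\mid gf\in I\}$; in particular $\mathrm{v}(I)=0$ if $I$ is prime. The regularity of $S/I$ is $\mathrm{reg}(S/I)=\max\{j-i\mid b_{i,j}\neq0\}$, where $b_{i,j}$ are the graded Betti numbers of the minimal graded free resolution of $S/I$ over $S$. *)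

(* Defs.v *)
From HB Require Import structures.
From mathcomp Require Import all_boot all_order all_algebra.
From mathcomp Require Import mpoly.

Set Implicit Arguments.
Unset Strict Implicit.
Unset Printing Implicit Defensive.

Import Order.TTheory GRing.Theory Num.Theory.

Local Open Scope ring_scope.

Section Matroid.
Variable T : finType.

Record matroid := Matroid {
  indep : {set {set T}};
  indep0 : set0 \in indep;
  indepS : forall A B : {set T}, A \subset B -> B \in indep -> A \in indep;
  indep_augment : forall A B : {set T}, A \in indep -> B \in indep ->
    (#|A| < #|B|)%N -> exists2 x, x \in B :\: A & x |: A \in indep
}.

Definition circuits (M : matroid) : {set {set T}} :=
  [set e | minset (fun A : {set T} => A \notin indep M) e].

End Matroid.

Section Ideals.
Variables (K : fieldType) (s : nat).
Local Notation S := {mpoly K[s]}.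

Implicit Types (I J p : S -> Prop) (f g : S).

Record is_ideal I : Prop := IsIdeal {
  ideal0 : I 0;
  idealD : forall f g, I f -> I g -> I (f + g);
  idealM : forall g f, I f -> I (g * f)
}.

Record is_prime p : Prop := IsPrime {
  prime_is_ideal : is_ideal p;
  prime_proper : ~ p 1;
  prime_mul : forall f g, p (f * g) -> p f \/ p g
}.

Definition colon I f : S -> Prop := fun g => I (g * f).

(* (I : f) is the annihilator of the class of f in S/I. *)
Definition associated_prime I p : Prop :=
  is_prime p /\ exists f, forall g, p g <-> colon I f g.

Definition is_vnumber I (v : nat) : Prop :=
  let attained d := exists f, f \is d.-homog /\
    exists p, associated_prime I p /\ forall g, colon I f g <-> p g in
  attained v /\ forall d, attained d -> (v <= d)%N.

Definition sqfree_monomial (e : {set 'I_s}) : S := \prod_(i in e) 'X_i.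

Definition circuit_ideal (M : matroid 'I_s) : S -> Prop := fun f =>
  exists c : {set 'I_s} -> S,
    f = \sum_(e in circuits M) c e * sqfree_monomial e.

(* F_i = \bigoplus_a S(- shift i a), a < rank i, is the module of row vectors
   of length rank i, and the differential F_(i+1) -> F_i is right
   multiplication by dif i. Natural number shifts are no restriction in a
   minimal resolution of S/I that starts with F_0 = S. *)
Record free_complex := FreeComplex {
  rank : nat -> nat;
  shift : forall i, 'I_(rank i) -> nat;
  dif : forall i, 'M[S]_(rank i.+1, rank i)
}.

Definition betti (F : free_complex) (i j : nat) : nat :=
  #|[set a : 'I_(rank F i) | shift a == j]|.

Record minimal_graded_resolution I (F : free_complex) : Prop := MinRes {
  (* F_0 = S, with augmentation the quotient map S -> S/I *)
  res_rank0 : rank F 0 = 1%N;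
  res_shift0 : forall a : 'I_(rank F 0), shift a = 0%N;
  (* the differentials are homogeneous of degree 0 *)
  res_graded : forall i (a : 'I_(rank F i.+1)) (b : 'I_(rank F i)),
    (shift b <= shift a)%N ->
    dif F i a b \is (shift a - shift b).-homog;
  res_graded0 : forall i (a : 'I_(rank F i.+1)) (b : 'I_(rank F i)),
    (shift a < shift b)%N -> dif F i a b = 0;
  res_exact0 : forall u : 'rV[S]_(rank F 0),
    (forall b, I (u 0 b)) <-> exists w, u = w *m dif F 0;
  res_exact : forall i (u : 'rV[S]_(rank F i.+1)),
    u *m dif F i = 0 <-> exists w, u = w *m dif F i.+1;
  (* the image of F_(i+1) lies in m F_i, where m = (t_1, ..., t_s) *)
  res_minimal : forall i (a : 'I_(rank F i.+1)) (b : 'I_(rank F i)),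
    (dif F i a b)@_0%MM = 0
}.

(* r = reg(S/I) *)
Definition is_regularity I (r : int) : Prop :=
  exists F, minimal_graded_resolution I F /\
    (exists i j, betti F i j <> 0%N /\ r = j%:Z - i%:Z) /\
    (forall i j, betti F i j <> 0%N -> j%:Z - i%:Z <= r).

End Ideals.

Arguments circuit_ideal K {s} M f.

(* Main.v *)
(* Let [L] be the set of coloops, [G] its complement and [rho] the rank of [M]
   minus [#|L|]. If [B] is a basis of [M] minus [L], then [(I : t_B)] is the prime
   generated by the variables outside [B :|: L], so [v(I) <= rho]. On the other
   hand [M] minus [L] has no coloop, so its independence complex carries a
   nonzero simplicial cycle [phi] of top dimension. By duality [phi] detects the
   Koszul class of [t_B e_(G - B)] over [S/I], of homological degree
   [p = #|G| - rho] and internal degree [#|G|]. Pushing this class along a free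
   resolution shows that the Betti number [b_(p, #|G|)] is nonzero, whence
   [rho <= reg(S/I)]. *)

Require Import Defs.
From HB Require Import structures.
From mathcomp Require Import all_boot all_order all_algebra.
From mathcomp Require Import mpoly.

Set Implicit Arguments.
Unset Strict Implicit.
Unset Printing Implicit Defensive.

Import Order.TTheory GRing.Theory Num.Theory.

Local Open Scope ring_scope.

(** * Exterior chains *)

Section Chains.
Variables (R : comNzRingType) (s : nat) (V : lmodType R).
Implicit Types (x y k : 'I_s) (W : {set 'I_s}) (om : 'I_s -> R).
Implicit Types c : {set 'I_s} -> V.

Definition sgn x W : R := (-1) ^+ #|[set y in W | (y < x)%N]|.

(** [c] stands for the chain $\sum_W c(W) e_W$, and the value at [W] collects the contributions of
    the sets [x |: W]. Weights 1 give the simplicial boundary, weights ['X_x] the Koszul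
    differential, and 0/1 weights the boundary of a single multigraded strand. *)
Definition boundary om c W : V :=
  \sum_(x | x \notin W) (om x * sgn x W) *: c (x |: W).

(** Left exterior multiplication by $e_k$, written on coefficients. *)
Definition wedge k c W : V :=
  if k \in W then sgn k (W :\ k) *: c (W :\ k) else 0.

Lemma sgn_sq x W : sgn x W * sgn x W = 1.
Proof. by rewrite -expr2 sqrr_sign. Qed.

Lemma sgnU1 x y W : x \notin W -> sgn y (x |: W) = (-1) ^+ (x < y)%N * sgn y W.
Proof.
move=> xW; rewrite /sgn -exprD; congr (_ ^+ _).
case: (boolP (x < y)%N) => [lt_xy | le_yx].
  rewrite (_ : [set z in x |: W | (z < y)%N] =
      x |: [set z in W | (z < y)%N]) ?cardsU1.
    by rewrite inE (negPf xW).
  by apply/setP=> z; rewrite !inE; case: (z =P x) => [->|]; rewrite ?lt_xy.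
rewrite add0n; apply: eq_card => z; rewrite !inE.
by case: (z =P x) => // ->; rewrite (negPf le_yx) !andbF.
Qed.

Lemma sgn_swap x y W : x != y -> x \notin W -> y \notin W ->
  sgn x W * sgn y (x |: W) = - (sgn y W * sgn x (y |: W)).
Proof.
move=> nxy xW yW; rewrite !sgnU1 // mulrCA [sgn y W * _]mulrCA [sgn y W * _]mulrC.
rewrite -mulNr; congr (_ * _); move: nxy; rewrite -val_eqE.
by case: ltngtP => //= _ _; rewrite ?opprK.
Qed.

Lemma sgn_cross x y W : x != y -> x \notin W -> y \notin W ->
  sgn y (x |: W) * sgn x (y |: W) = - (sgn x W * sgn y W).
Proof.
move=> nxy xW yW; rewrite !sgnU1 // mulrACA [sgn y W * _]mulrC -[RHS]mulN1r.
congr (_ * _); move: nxy; rewrite -val_eqE.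
by case: ltngtP => //= _ _; rewrite ?mul1r ?mulr1.
Qed.

Lemma boundaryD om c c' W :
  boundary om (fun U => c U + c' U) W = boundary om c W + boundary om c' W.
Proof. by rewrite -big_split; apply: eq_bigr => x _; rewrite scalerDr. Qed.

Lemma boundaryN om c W : boundary om (fun U => - c U) W = - boundary om c W.
Proof. by rewrite -sumrN; apply: eq_bigr => x _; rewrite scalerN. Qed.

Lemma eq_boundary om c c' W : c =1 c' -> boundary om c W = boundary om c' W.
Proof. by move=> eqc; apply: eq_bigr => x _; rewrite eqc. Qed.

Lemma boundaryK om c W : boundary om (boundary om c) W = 0.
Proof.
pose F x y := (om x * sgn x W * (om y * sgn y (x |: W))) *: c (y |: (x |: W)).
have FN x y : x != y -> x \notin W -> y \notin W -> F x y = - F y x.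
  move=> nxy xW yW; rewrite /F setUCA -scaleNr; congr (_ *: _).
  by rewrite mulrACA sgn_swap // mulrN [om x * om y]mulrC mulrACA.
pose P x y := [&& x != y, x \notin W & y \notin W].
have ->: boundary om (boundary om c) W = \sum_x \sum_(y | P x y) F x y.
  rewrite /boundary big_mkcond; apply: eq_bigr => x _; case: ifP => xW.
    rewrite scaler_sumr; apply: eq_big => [y|y _]; last by rewrite scalerA.
    by rewrite /P !inE negb_or xW eq_sym.
  by rewrite big_pred0 // => y; rewrite /P xW andbF.
(* Folding onto the pairs with [x < y] puts [F x y] next to [F y x], so the cancellation is valid in
   every characteristic. *)
have ->: \sum_x \sum_(y | P x y) F x y =
      \sum_x \sum_(y | P x y && (x < y)%N) (F x y + F y x).
  transitivity (\sum_x \sum_(y | P x y && (x < y)%N) F x y +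
    \sum_x \sum_(y | P x y && ~~ (x < y)%N) F x y).
    rewrite -big_split; apply: eq_bigr => x _.
    by rewrite (bigID (fun y => (x < y)%N)).
  rewrite [X in _ + X](exchange_big_dep predT) //= -big_split; apply: eq_bigr => x _.
  rewrite big_split; congr (_ + _); apply: eq_bigl => y; rewrite /P eq_sym.
  rewrite -!andbA; case: eqVneq => //= nxy; rewrite andbCA -leqNgt.
  by rewrite [(_ <= _)%N]leq_eqVlt val_eqE (negPf nxy).
rewrite big1 // => x _; rewrite big1 // => y /andP[/and3P[nxy xW yW] _].
by rewrite FN // addNr.
Qed.

(** Leibniz rule: the boundary is the antiderivation with $e_k \mapsto om(k)$. When [om k] is 1,
    wedging with $e_k$ is a contracting homotopy. *)
Lemma boundary_wedge om k c W :
  boundary om (wedge k c) W = om k *: c W - wedge k (boundary om c) W.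
Proof.
rewrite /wedge; case: ifP => [kW | /negbT kW].
  pose W' := W :\ k; have defW: W = k |: W' by rewrite setD1K.
  have kW' : k \notin W' by rewrite !inE eqxx.
  rewrite -/W' /boundary [X in sgn k W' *: X](bigD1 k) //= scalerDr -defW.
  rewrite scalerA mulrCA sgn_sq mulr1 opprD addNKr scaler_sumr -sumrN.
  apply: eq_big => [x | x xW]; first by rewrite defW !inE negb_or andbC.
  have nxk: k != x by apply: contraNneq xW => <-.
  have xW' : x \notin W' by apply: contra xW; rewrite !inE => /andP[].
  rewrite !inE kW orbT (_ : (x |: W) :\ k = x |: W'); last first.
    by apply/setP=> y; rewrite !inE; case: (y =P x) => // ->; rewrite eq_sym nxk.
  rewrite !scalerA -scaleNr; congr (_ *: _).
  by rewrite {1}defW -mulrA sgn_cross // mulrN mulrCA mulrA mulrC.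
rewrite subr0 /boundary (bigD1 k) //= big1 => [|x /andP[xW nxk]].
  by rewrite addr0 !inE eqxx setU1K // scalerA -mulrA sgn_sq mulr1.
by rewrite !inE eq_sym (negPf nxk) (negPf kW) scaler0.
Qed.

End Chains.

(** * Top cycles of matroid complexes *)

Section Bases.
Variable T : finType.
Implicit Types (M : matroid T) (A B D : {set T}).

Definition base M A :=
  (A \in indep M) && [forall (B | B \in indep M), (#|B| <= #|A|)%N].

Lemma baseP M A :
  reflect (A \in indep M /\ forall B, B \in indep M -> (#|B| <= #|A|)%N) (base M A).
Proof. by apply: (iffP andP) => [] [iA /forall_inP maxA]. Qed.

(** Iterated augmentation from [B]. The bound [C \subset A :|: B] lets the extension avoid a
    prescribed element. *)
Lemma indep_extend M A B : A \in indep M -> B \in indep M -> (#|A| <= #|B|)%N ->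
  exists C, [/\ C \in indep M, A \subset C, C \subset A :|: B & #|C| = #|B|].
Proof.
move=> + iB; elim: {A}_.+1 {-2}A (ltnSn (#|B| - #|A|)) => // n IHn A ltn iA leAB.
have [eqAB | neqAB] := eqVneq #|A| #|B|.
  by exists A; rewrite subsetUl.
have ltAB : (#|A| < #|B|)%N by rewrite ltn_neqAle neqAB.
have [x /setDP[xB xA] iAx] := indep_augment iA iB ltAB.
have cAx : #|x |: A| = #|A|.+1 by rewrite cardsU1 xA.
have [||//|C [iC sAC sCB cC]] := IHn (x |: A); rewrite ?cAx //.
  by rewrite subnS; move: ltn; rewrite -subn_gt0 in ltAB; case: (#|B| - #|A|)%N ltAB.
exists C; split=> //; first exact: subset_trans (subsetUr _ _) sAC.
by apply: subset_trans sCB _; rewrite -setUA subUset sub1set !inE xB orbT subxx.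
Qed.

Lemma base_extend M A : A \in indep M -> exists2 D, base M D & A \subset D.
Proof.
move=> iA; pose P D := (D \in indep M) && (A \subset D).
have PA : P A by rewrite /P iA subxx.
have [D /andP[iD sAD] maxD] := @arg_maxnP _ A P (fun D => #|D|) PA.
exists D => //; apply/baseP; split=> // B iB; rewrite leqNgt; apply/negP => ltDB.
have [x /setDP[_ xD] iDx] := indep_augment iD iB ltDB.
have /maxD: P (x |: D) by rewrite /P iDx (subset_trans sAD) ?subsetUr.
by rewrite /= cardsU1 xD add1n ltnn.
Qed.

Lemma base_card M A B : base M A -> base M B -> #|A| = #|B|.
Proof.
move=> /baseP[iA maxA] /baseP[iB maxB]; apply/eqP.
by rewrite eqn_leq maxA ?maxB.
Qed.

Lemma card_base M A B : base M A -> B \in indep M -> #|B| = #|A| -> base M B.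
Proof.
move=> /baseP[iA maxA] iB eqBA.
by apply/baseP; split=> // C; rewrite eqBA; apply: maxA.
Qed.

(** * Deletion and contraction on a fixed ground set *)

Section Deletion.
Variables (M : matroid T) (D : {set T}).

Let dfam := [set A in indep M | [disjoint A & D]].

Fact del_indep0 : set0 \in dfam.
Proof. by rewrite inE indep0 -setI_eq0 set0I eqxx. Qed.

Fact del_indepS A B : A \subset B -> B \in dfam -> A \in dfam.
Proof.
move=> sAB; rewrite !inE => /andP[iB dB].
by rewrite (indepS sAB iB) (disjointWl sAB dB).
Qed.

Fact del_augment A B : A \in dfam -> B \in dfam -> (#|A| < #|B|)%N ->
  exists2 x, x \in B :\: A & x |: A \in dfam.
Proof.
rewrite !inE => /andP[iA dA] /andP[iB dB] /(indep_augment iA iB)[x xBA iAx].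
exists x => //; rewrite inE iAx -setI_eq0 setIUl setU_eq0 !setI_eq0 disjoints1 dA andbT.
by have /setDP[xB _] := xBA; rewrite (disjointFr dB).
Qed.

(* The elements of [D] become loops, so that the ground set is unchanged. *)
Definition deletion := Matroid del_indep0 del_indepS del_augment.

Lemma in_deletion A : (A \in indep deletion) = (A \in indep M) && [disjoint A & D].
Proof. by rewrite inE. Qed.

End Deletion.

Section Contraction.
Variables (M : matroid T) (e : T).
Hypothesis ie : [set e] \in indep M.

Let cfam := [set A : {set T} | (e \notin A) && (e |: A \in indep M)].

Fact contr_indep0 : set0 \in cfam.
Proof. by rewrite !inE setU0 ie. Qed.

Fact contr_indepS A B : A \subset B -> B \in cfam -> A \in cfam.
Proof.
move=> sAB; rewrite !inE => /andP[eB ieB].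
by rewrite (contra (subsetP sAB e)) // (indepS _ ieB) // setUS.
Qed.

Fact contr_augment A B : A \in cfam -> B \in cfam -> (#|A| < #|B|)%N ->
  exists2 x, x \in B :\: A & x |: A \in cfam.
Proof.
rewrite !inE => /andP[eA ieA] /andP[eB ieB] ltAB.
have [|x] := indep_augment ieA ieB; first by rewrite !cardsU1 eA eB.
rewrite !inE negb_or -andbA => /and3P[nxe xA] /=; rewrite (negPf nxe) /= => xB ieAx.
by exists x; rewrite !inE ?xA // eq_sym (negPf nxe) eA setUCA.
Qed.

(** The contracted element [e] becomes a loop, so the ground set again stays the same. *)
Definition contraction := Matroid contr_indep0 contr_indepS contr_augment.

Lemma in_contraction A :
  (A \in indep contraction) = (e \notin A) && (e |: A \in indep M).
Proof. by rewrite inE. Qed.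

End Contraction.

(** * Coloops under contraction and deletion *)

Definition coloop_free M := [forall x, exists A, base M A && (x \notin A)].

Lemma coloop_freeP M :
  reflect (forall x, exists2 A, base M A & x \notin A) (coloop_free M).
Proof.
by apply: (iffP forallP) => cf x; [have /existsP[A /andP[]] := cf x; exists A |
  apply/existsP; have [A ? ?] := cf x; exists A; apply/andP].
Qed.

Definition coloops M := [set x | [forall (A | base M A), x \in A]].

Lemma coloopsP M x : reflect (forall A, base M A -> x \in A) (x \in coloops M).
Proof. by rewrite inE; apply: forall_inP. Qed.

Lemma base_contraction M e (ie : [set e] \in indep M) A :
  e \notin A -> base (contraction ie) A = base M (e |: A).
Proof.
move=> eA; apply/baseP/baseP => [] [].
  rewrite in_contraction eA andTb => ieA maxA; split=> // B iB.
  case: (posnP #|B|) => [-> // | B_gt0].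
  have [|C [iC sC _ <-]] := indep_extend ie iB; first by rewrite cards1.
  have eC : e \in C by rewrite -sub1set.
  rewrite [#|C|](cardsD1 e) eC cardsU1 eA ltnS maxA //.
  by rewrite in_contraction setD1K // !inE eqxx.
rewrite in_contraction eA andTb => ieA maxA; split=> // B.
rewrite in_contraction => /andP[eB /maxA].
by rewrite !cardsU1 eA eB.
Qed.

(** Extending [[set e]] by elements of a basis [C] that avoids [x] gives a basis [B] inside
    [e |: C]; then [B :\ e] lies in [C] and still avoids [x]. *)
Lemma coloop_free_contraction M e (ie : [set e] \in indep M) :
  coloop_free M -> coloop_free (contraction ie).
Proof.
move=> /coloop_freeP cfM; apply/coloop_freeP => x.
have [C bC xC] : exists2 C, base M C & x \notin C :\ e.
  have [C bC xC] := cfM x; exists C => //.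
  by rewrite !inE (negPf xC) andbF.
have /baseP[iC maxC] := bC.
have [|B [iB sB sBC cB]] := indep_extend ie iC; first exact: maxC.
have eB : e \in B by rewrite -sub1set.
exists (B :\ e); first by rewrite base_contraction ?setD1K ?(card_base bC) // !inE eqxx.
apply: contra xC; rewrite !inE => /andP[nxe xB]; rewrite nxe.
by have := subsetP sBC x xB; rewrite !inE (negPf nxe).
Qed.

(** Every basis of [M] contains all coloops, so removing them from a basis of [M] leaves a basis of
    the deletion. An element that is no coloop is missed by some basis of [M], and a coloop is
    missed by all these differences. *)
Lemma coloop_free_del_coloops M : coloop_free (deletion M (coloops M)).
Proof.
set L := coloops M; apply/coloop_freeP => x.
have baseL A : base M A -> base (deletion M L) (A :\: L).
  move=> bA; have /baseP[iA maxA] := bA.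
  have sL C : base M C -> L \subset C.
    by move=> bC; apply/subsetP => y /coloopsP; apply.
  apply/baseP; split.
    rewrite in_deletion (indepS (subsetDl _ _) iA) disjoint_sym -setI_eq0.
    by rewrite setIDA setDIl setDv set0I eqxx.
  move=> B; rewrite in_deletion => /andP[iB dB].
  have [C bC sBC] := base_extend iB.
  rewrite cardsD (setIidPr (sL _ bA)) (base_card bA bC).
  rewrite -(setIidPr (sL _ bC)) -cardsD.
  by rewrite subset_leq_card // subsetD sBC.
have [A bA] := base_extend (indep0 M).
case: (boolP (x \in L)) => xL _.
  by exists (A :\: L); rewrite ?baseL // inE xL.
have : ~~ [forall (A | base M A), x \in A] by move: xL; rewrite inE.
rewrite negb_forall_in => /exists_inP[B bB xB].
by exists (B :\: L); rewrite ?baseL // inE (negPf xB) andbF.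
Qed.

End Bases.

Section TopCycle.
Variables (K : fieldType) (s : nat).

(* The top homology of the independence complex of a coloop-free matroid does
   not vanish. If deleting [e] creates a coloop [f], then a cycle [c] of the
   contraction at [e] yields the cycle [(e - f) /\ c]. *)
Lemma coloop_free_top_cycle (M : matroid 'I_s) : coloop_free M ->
  exists phi : {set 'I_s} -> K^o,
    [/\ exists A, phi A != 0, forall A, phi A != 0 -> base M A
      & forall W, boundary (fun=> 1) phi W = 0].
Proof.
elim: {M}_.+1 {-2}M (ltnSn #|indep M|) => // n IHn M; rewrite ltnS => leMn cfM.
have [e ie | noe] := pickP (fun e => [set e] \in indep M); last first.
  (* All elements are loops: the complex is $\{\emptyset\}$, and the empty face itself is a reduced
     cycle. *)
  have b0 A : A \in indep M -> A = set0.
    move=> iA; apply/eqP; apply/set0Pn => - [e eA]; move: (noe e).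
    by rewrite (@indepS _ M _ A) ?sub1set.
  exists (fun A => (A == set0)%:R); split.
  - by exists set0; rewrite eqxx oner_eq0.
  - move=> A; case: (A =P set0) => [-> _ | _ /eqP //].
    by apply/baseP; split; rewrite ?indep0 // => B /b0->.
  - move=> W; rewrite /boundary big1 // => x xW.
    by rewrite -cards_eq0 cardsU1 xW scaler0.
pose Me := deletion M [set e].
have inMe A : (A \in indep Me) = (A \in indep M) && (e \notin A).
  by rewrite in_deletion disjoint_sym disjoints1.
have [cfMe | ] := boolP (coloop_free Me).
  have ltMe : (#|indep Me| < n)%N.
    apply: leq_trans leMn; apply: proper_card.
    apply/properP; split; first by apply/subsetP => A; rewrite inMe => /andP[].
    by exists [set e] => //; rewrite inMe inE eqxx andbF.
  have [phi [nz_phi bphi dphi]] := IHn Me ltMe cfMe; exists phi; split=> // A.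
  move=> /bphi/baseP[]; rewrite inMe => /andP[iA eA] maxA.
  (* A basis of [M] avoiding [e] survives the deletion, so [Me] and [M] have the same rank. *)
  have [C bC eC] := coloop_freeP _ cfM e; have /baseP[iC maxC] := bC.
  apply: (card_base bC) => //; apply/eqP; rewrite eqn_leq maxC //=.
  by rewrite maxA // inMe iC.
rewrite negb_forall => /existsP[f]; rewrite negb_exists => /forallP all_f.
have bMe_f A : base Me A -> f \in A.
  by move=> bA; have := all_f A; rewrite bA negbK.
have nef : e != f.
  have [A bA _] := base_extend (indep0 Me).
  have /baseP[] := bA; rewrite inMe => /andP[_ eA] _.
  by apply: contraNneq eA => ->; apply: bMe_f.
have ltM' : (#|indep (contraction ie)| < n)%N.
  apply: leq_trans leMn; apply: proper_card.
  apply/properP; split.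
    apply/subsetP => A; rewrite in_contraction => /andP[_].
    by apply: indepS; apply: subsetUr.
  by exists [set e] => //; rewrite in_contraction inE eqxx.
have [c [[A0 nzA0] bc dc]] := IHn _ ltM' (coloop_free_contraction ie cfM).
have c_base A : c A != 0 -> e \notin A /\ base M (e |: A).
  move=> /bc bA; have /baseP[] := bA; rewrite in_contraction => /andP[eA _] _.
  by rewrite base_contraction in bA.
exists (fun A => wedge e c A - wedge f c A); split.
(* Since [c] vanishes on sets containing [e], only the [e]-term survives at [e |: A0]. *)
- have [eA0 _] := c_base A0 nzA0; exists (e |: A0).
  rewrite /wedge !inE eqxx /= setU1K // (eq_sym f) (negPf nef) /=.
  have cf : c ((e |: A0) :\ f) = 0.
    by apply/eqP; apply: contraTT isT => /c_base[]; rewrite !inE eqxx nef.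
  rewrite cf scaler0 if_same subr0 scaler_eq0 negb_or nzA0 andbT.
  by rewrite signr_eq0.
- move=> A; case: (boolP (wedge e c A == 0)) => [/eqP-> | nz _]; last first.
    move: nz; rewrite /wedge; case: ifP => [eA | _]; last by rewrite eqxx.
    by rewrite scaler_eq0 negb_or => /andP[_ /c_base[_]]; rewrite setD1K.
  rewrite sub0r oppr_eq0 /wedge; case: ifP => [fA | _]; last by rewrite eqxx.
  rewrite scaler_eq0 negb_or => /andP[_ /c_base[eA' bA']].
  have /baseP[iA' _] := bA'.
  (* Any basis of [Me] above [A :\ f] contains [f], hence all of [A]; this makes [A] independent. *)
  have iAf : A :\ f \in indep Me by rewrite inMe eA' andbT (indepS (subsetUr _ _) iA').
  have [D bD sAD] := base_extend iAf.
  have /baseP[] := bD; rewrite inMe => /andP[iD _] _.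
  have sA : A \subset D by rewrite -(setD1K fA) subUset sub1set bMe_f.
  apply: (card_base bA'); first exact: indepS iD.
  by rewrite [in LHS](cardsD1 f) fA cardsU1 eA'.
(* By the Leibniz rule both wedges contribute the same [c], which cancels, and the remaining terms
   contain the boundary of [c]. *)
- move=> W; rewrite boundaryD boundaryN !boundary_wedge !scale1r.
  rewrite /wedge !dc !scaler0 !if_same !subr0; exact: subrr.
Qed.

End TopCycle.

(** * Koszul complexes over polynomial rings *)

Section Koszul.
Variables (K : fieldType) (s : nat).
Local Notation S := {mpoly K[s]}.
Implicit Types (W A : {set 'I_s}) (m n : 'X_{1..s}) (p : S).

Definition mset m : {set 'I_s} := [set i | m i != 0%N].

Definition mind A : 'X_{1..s} := [multinom (i \in A : nat) | i < s].

Lemma mindE A i : mind A i = (i \in A).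
Proof. by rewrite mnmE. Qed.

Lemma mset_mind A : mset (mind A) = A.
Proof. by apply/setP=> i; rewrite inE mindE; case: (i \in A). Qed.

Lemma mset_eq0 m : (mset m == set0) = (m == 0%MM).
Proof.
apply/eqP/eqP => [m0 | ->]; last by apply/setP=> i; rewrite !inE mnm0E.
apply/mnmP=> i; rewrite mnm0E; apply/eqP.
by have := in_set0 i; rewrite -m0 inE => /negbFE.
Qed.

Lemma mdeg_mind A : mdeg (mind A) = #|A|.
Proof.
rewrite mdegE -sum1_card [RHS]big_mkcond; apply: eq_bigr => i _.
by rewrite mindE; case: (i \in A).
Qed.

Lemma mindU1 x A : x \notin A -> mind (x |: A) = (U_(x) + mind A)%MM.
Proof.
move=> xA; apply/mnmP=> i; rewrite mnmDE !mindE mnm1E !inE (eq_sym i).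
by case: eqP => // <-; rewrite (negPf xA).
Qed.

Lemma mind_le A m : (mind A <= m)%MM = (A \subset mset m).
Proof.
apply/mnm_lepP/subsetP => [le i iA | sA i].
  by have := le i; rewrite inE mindE iA lt0n.
by rewrite mindE; case: (boolP (i \in A)) => // /sA; rewrite inE lt0n.
Qed.

Lemma mcoeff_XM x p m :
  ('X_x * p)@_m = if m x != 0%N then p@_(m - U_(x))%MM else 0.
Proof.
rewrite mulrC; case: ifP => mx.
  have le_xm : (U_(x) <= m)%MM.
    by apply/mnm_lepP=> i; rewrite mnm1E; case: eqP => // <-; rewrite lt0n mx.
  by rewrite -{1}(submK le_xm) addmC mcoeffMX.
apply/eqP; rewrite mcoeff_eq0 (perm_mem (msuppMX _ _)); apply/mapP=> -[m' _ defm].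
by move: mx; rewrite defm mnmDE mnm1E eqxx.
Qed.

Lemma mcoeff_signM k p m : ((-1) ^+ k * p)@_m = (-1) ^+ k * p@_m.
Proof.
by rewrite -signr_odd -[in RHS]signr_odd; case: odd;
  rewrite ?mulN1r ?mcoeffN ?mul1r.
Qed.

Lemma mcoeff_boundary (c : {set 'I_s} -> S^o) W m :
  (boundary (fun x => 'X_x) c W)@_m =
  \sum_(x | x \notin W)
    if m x != 0%N then sgn K x W * (c (x |: W))@_(m - U_(x))%MM else 0.
Proof.
rewrite raddf_sum; apply: eq_bigr => x _ /=.
by rewrite /GRing.scale /= -mulrA mcoeff_XM mcoeff_signM.
Qed.

Lemma mpoly_of_coeffs (f : 'X_{1..s} -> K) N :
  (forall m, f m != 0 -> (mdeg m < N)%N) -> exists p : S, forall m, p@_m = f m.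
Proof.
move=> fN; exists (\sum_(m : 'X_{1..s < N}) f m *: 'X_[m]) => m.
have [/mcoeff_mpoly-> // | leNm] := ltnP (mdeg m) N.
have /eqP-> : f m == 0 by apply: contraLR leNm; rewrite -ltnNge; apply: fN.
rewrite raddf_sum big1 //= => i _; rewrite mcoeffZ mcoeffX.
case: eqP => [im | _]; last by rewrite mulr0.
by have := bmdeg i; rewrite im ltnNge leNm.
Qed.

(* The part of multidegree [n], where [e_W] has multidegree [mind W]. *)
Definition multipart n (c : {set 'I_s} -> S^o) W : K^o :=
  if W \subset mset n then (c W)@_(n - mind W)%MM else 0.

Lemma multipart_addm (c : {set 'I_s} -> S^o) W m :
  multipart (m + mind W)%MM c W = (c W)@_m.
Proof. by rewrite /multipart -mind_le lem_addl addmK. Qed.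

(** Multiplying by $t_x$ shifts exponents exactly as passing from [x |: W] to [W] shifts [mind].
    Hence the strand of multidegree [n] only sees 0/1 weights: it is the chain complex of the full
    simplex on [mset n]. *)
Lemma boundary_multipart n (c : {set 'I_s} -> S^o) W :
  boundary (fun x => (n x != 0%N)%:R) (multipart n c) W =
  multipart n (boundary (fun x => 'X_x) c) W.
Proof.
rewrite /multipart; case: ifP => sW; last first.
  rewrite /boundary big1 // => x _; rewrite ifF ?scaler0 //.
  by apply: contraFF sW; apply: subset_trans (subsetUr _ _).
rewrite mcoeff_boundary; apply: eq_bigr => x xW.
rewrite mnmBE mindE (negPf xW) subn0; case: eqP => /= nx; last first.
  rewrite mul1r subUset sub1set inE sW andbT; case: eqP => // _ /=.
  by rewrite mindU1 // addmC submDA.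
by rewrite mul0r scale0r.
Qed.

(* Each multigraded strand is the chain complex of a simplex, and coning from
   any vertex contracts it. *)
Lemma koszul_exact (c : {set 'I_s} -> S^o) :
  (forall W, boundary (fun x => 'X_x) c W = 0) -> (c set0)@_0%MM = 0 ->
  exists w : {set 'I_s} -> S^o, forall W, boundary (fun x => 'X_x) w W = c W.
Proof.
move=> dc c0.
(* The vertex [k] depends only on the multidegree [n], so the same cone is used along a whole
   strand. *)
pose h W m : K^o := let n := (m + mind W)%MM in
  if [pick k in mset n] is Some k then wedge k (multipart n c) W else 0.
have [w hw] : exists w : {set 'I_s} -> S^o, forall W m, (w W)@_m = h W m.
  apply: (@fin_all_exists _ _ (fun W (q : S^o) => forall m, q@_m = h W m)) => W.
  (* A nonzero coefficient of [h W] at [m] comes from one of [c (W :\ k)] in degree [mdeg m + 1];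
     the sum bounds all these sizes at once. *)
  apply: (@mpoly_of_coeffs (h W) (\sum_W' msize (c W'))%N) => m.
  rewrite /h /=; case: pickP => [k kn | _]; last by rewrite eqxx.
  rewrite /wedge; case: ifP => [kW | _]; last by rewrite eqxx.
  move=> nz_h; have : multipart (m + mind W)%MM c (W :\ k) != 0.
    by apply: contraNneq nz_h => ->; rewrite scaler0.
  rewrite /multipart; case: ifP => _; last by rewrite eqxx.
  rewrite -mcoeff_msupp -[in mind W](setD1K kW) mindU1 ?inE ?eqxx // addmA addmK.
  move/msize_mdeg_lt; rewrite mdegD mdeg1 addn1 => /ltnW lt_c.
  by apply: leq_trans lt_c _; rewrite (bigD1 (W :\ k)) //= leq_addr.
have wpart n k : [pick k in mset n] = Some k ->
    multipart n w =1 wedge k (multipart n c).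
  move=> defk W; have kn : k \in mset n by case: pickP defk => // k' + [<-].
  rewrite {1}/multipart; case: ifP => sW.
    by rewrite hw /h /= submK ?mind_le // defk.
  rewrite /wedge; case: ifP => // kW; rewrite /multipart ifF ?scaler0 //.
  by apply: contraFF sW => sW; rewrite -(setD1K kW) subUset sub1set kn.
exists w => W; apply/mpolyP => m; pose n := (m + mind W)%MM.
rewrite -!multipart_addm -boundary_multipart -/n.
case defk: [pick k in mset n] => [k|].
  rewrite (eq_boundary _ _ (wpart n k defk)) boundary_wedge.
  have kn : k \in mset n by case: pickP defk => // k' + [<-].
  rewrite inE in kn; rewrite kn scale1r /wedge; case: ifP => _; last by rewrite subr0.
  by rewrite boundary_multipart /multipart dc mcoeff0 if_same scaler0 subr0.
(* The strand of multidegree 0 has no vertex to cone from; it consists of the constant term on the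
   empty set, which [c0] kills. *)
have n0 : n = 0%MM.
  apply/eqP; rewrite -mset_eq0; apply/set0Pn => -[k kn].
  by case: pickP defk => // /(_ k); rewrite kn.
have W0 : W = set0.
  have : W \subset mset n by rewrite -mind_le lem_addl.
  by have /eqP := n0; rewrite -mset_eq0 => /eqP->; rewrite subset0 => /eqP.
rewrite W0 n0 [LHS]big1 => [|x _]; last by rewrite mnm0E eqxx mul0r scale0r.
have m0 : mind set0 = 0%MM by apply/eqP; rewrite -mset_eq0 mset_mind.
by rewrite /multipart sub0set m0 subm0 c0.
Qed.

Lemma boundary_entry d (c : {set 'I_s} -> 'rV[S]_d) W a :
  boundary (fun x => 'X_x) c W 0 a =
  boundary (fun x => 'X_x) (fun U => c U 0 a : S^o) W.
Proof. by rewrite summxE; apply: eq_bigr => x _; rewrite mxE. Qed.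

Lemma koszul_exact_row d (c : {set 'I_s} -> 'rV[S]_d) :
  (forall W, boundary (fun x => 'X_x) c W = 0) ->
  (forall a, (c set0 0 a)@_0%MM = 0) ->
  exists w : {set 'I_s} -> 'rV[S]_d, forall W, boundary (fun x => 'X_x) w W = c W.
Proof.
move=> dc c0.
have [w hw] : exists w : 'I_d -> {set 'I_s} -> S^o,
    forall a W, boundary (fun x => 'X_x) (w a) W = c W 0 a.
  apply: (@fin_all_exists _ (fun=> {set 'I_s} -> S^o)
    (fun a q => forall W, boundary (fun x => 'X_x) q W = c W 0 a)) => a.
  by apply: koszul_exact => // W; rewrite -boundary_entry dc mxE.
exists (fun W => \row_a w a W) => W; apply/rowP => a; rewrite boundary_entry -hw.
by apply: (@eq_boundary _ s S^o) => U; rewrite mxE.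
Qed.

End Koszul.

(** * Koszul classes along a resolution *)

Section Resolution.
Variables (K : fieldType) (s : nat).
Local Notation S := {mpoly K[s]}.
Variables (I : S -> Prop) (F : free_complex K s).
Hypothesis resF : minimal_graded_resolution I F.

Lemma mcoeff_mulmx p q (u : 'rV[S]_p) (D : 'M[S]_(p, q)) b (m : 'X_{1..s}) :
  ((u *m D) 0 b)@_m != 0 -> exists a m1 m2,
    [/\ m1 \in msupp (u 0 a), m2 \in msupp (D a b) & m = (m1 + m2)%MM].
Proof.
rewrite mxE raddf_sum; have [/existsP[a nz] _ | ] :=
  boolP [exists a, (u 0 a * D a b)@_m != 0].
  move: nz; rewrite -mcoeff_msupp => /msuppM_le/allpairsP[[m1 m2] /= [m1P m2P ->]].
  by exists a, m1, m2.
rewrite negb_exists => /forallP z0; rewrite big1 ?eqxx // => a _.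
by apply/eqP; rewrite -[_ == _]negbK z0.
Qed.

Lemma dif_msupp i (a : 'I_(rank F i.+1)) (b : 'I_(rank F i)) m :
  m \in msupp (dif F i a b) -> (mdeg m + shift b)%N = shift a.
Proof.
move=> mP; have [le_ba | lt_ab] := leqP (shift b) (shift a).
  have /dhomogP/(_ m mP) /= -> := res_graded resF le_ba.
  by rewrite subnK.
by rewrite (res_graded0 resF lt_ab) msupp0 in mP.
Qed.

(** Differentials preserve total degree. A general predicate [P] covers both uses in [graded_lift]:
    total degree [j], and total degree different from [j]. The offset [k] is the exterior degree. *)
Lemma mulmx_dif_msupp i (P : pred nat) k (u : 'rV[S]_(rank F i.+1)) :
  (forall a m, m \in msupp (u 0 a) -> P (k + mdeg m + shift a)%N) ->
  forall b m, m \in msupp ((u *m dif F i) 0 b) -> P (k + mdeg m + shift b)%N.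
Proof.
move=> Pu b m; rewrite mcoeff_msupp => /mcoeff_mulmx[a [m1 [m2 [m1P m2P ->]]]].
by rewrite mdegD addnA -addnA (dif_msupp m2P); apply: Pu.
Qed.

(** Take for [v] the part of [u] in total degree [j]. The discarded part maps to other degrees, in
    which [y] has no terms. *)
Lemma graded_lift i k j (y : 'rV[S]_(rank F i)) (u : 'rV[S]_(rank F i.+1)) :
  y = u *m dif F i ->
  (forall b m, m \in msupp (y 0 b) -> (k + mdeg m + shift b)%N = j) ->
  exists2 v : 'rV[S]_(rank F i.+1), y = v *m dif F i &
    forall a m, m \in msupp (v 0 a) -> (k + mdeg m + shift a)%N = j.
Proof.
move=> yE ydeg.
have [v0 vE] : exists v0 : 'I_(rank F i.+1) -> S, forall a m, (v0 a)@_m =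
    if (k + mdeg m + shift a == j)%N then (u 0 a)@_m else 0.
  apply: (@fin_all_exists _ (fun=> S) (fun a p => forall m, p@_m =
    if (k + mdeg m + shift a == j)%N then (u 0 a)@_m else 0)) => a.
  apply: (@mpoly_of_coeffs _ _ _ (msize (u 0 a))) => m.
  by case: ifP => _; rewrite ?eqxx // -mcoeff_msupp => /msize_mdeg_lt.
pose v := \row_a v0 a.
have vdeg a m : m \in msupp (v 0 a) -> (k + mdeg m + shift a)%N = j.
  by rewrite mxE mcoeff_msupp vE; case: ifP => [/eqP // | _]; rewrite eqxx.
exists v => //; apply/rowP => b; apply/mpolyP => m.
have [mj | /eqP mj] := eqVneq (k + mdeg m + shift b)%N j; last first.
  have z_of (z : 'rV[S]_(rank F i)) :
      (forall b m, m \in msupp (z 0 b) -> (k + mdeg m + shift b)%N = j) ->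
      (z 0 b)@_m = 0.
    by move=> zP; apply/eqP; rewrite mcoeff_eq0; apply/negP => /zP.
  rewrite !z_of // => b' m' m'P; apply/eqP.
  by apply: (mulmx_dif_msupp (P := pred1 j)) m'P => a m'' /vdeg /= ->.
apply/eqP; rewrite yE -subr_eq0 -mcoeffB.
have -> : (u *m dif F i) 0 b - (v *m dif F i) 0 b = ((u - v) *m dif F i) 0 b.
  by rewrite mulmxBl !mxE.
have uvdeg a m' : m' \in msupp ((u - v) 0 a) ->
    predC1 j (k + mdeg m' + shift a)%N.
  rewrite mcoeff_msupp !mxE mcoeffB vE /=.
  by case: ifP => // _; rewrite subrr eqxx.
rewrite mcoeff_eq0; apply/negP => /(mulmx_dif_msupp uvdeg) /=.
by rewrite mj eqxx.
Qed.

Lemma boundary_mulmx p q (D : 'M[S]_(p, q)) (c : {set 'I_s} -> 'rV[S]_p) W :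
  boundary (fun x => 'X_x) (fun U => c U *m D) W =
  boundary (fun x => 'X_x) c W *m D.
Proof. by rewrite mulmx_suml; apply: eq_bigr => x _; rewrite scalemxAl. Qed.

Lemma boundary_msupp d (c : {set 'I_s} -> 'rV[S]_d) W a m :
  m \in msupp (boundary (fun x => 'X_x) c W 0 a) ->
  exists x m', [/\ x \notin W, m' \in msupp (c (x |: W) 0 a)
    & m = (U_(x) + m')%MM].
Proof.
rewrite mcoeff_msupp summxE raddf_sum => nz.
have [/exists_inP[x xW] | ] := boolP [exists (x | x \notin W),
    (('X_x * sgn S x W * c (x |: W) 0 a) : S)@_m != 0].
  rewrite -mulrA mcoeff_XM; case: ifP => [mx | _]; last by rewrite eqxx.
  rewrite mcoeff_signM mulf_eq0 negb_or -mcoeff_msupp => /andP[_ mP].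
  exists x, (m - U_(x))%MM; split=> //; rewrite addmC submK //.
  by apply/mnm_lepP=> i; rewrite mnm1E; case: eqP => // <-; rewrite lt0n.
rewrite negb_exists_in => /forall_inP z0; move: nz; rewrite big1 ?eqxx // => x xW.
by apply/eqP; rewrite mxE -[_ == _]negbK z0.
Qed.

(* The Koszul homology in homological degree [p] and internal degree [j] of the
   cokernel of [dif F i] embeds, by iterated connecting homomorphisms, into that
   in degree [0] of the cokernel of [dif F (i + p)]; the latter vanishes when
   [F_(i+p)] has no generator of degree [j]. *)
Lemma koszul_class_trivial j p i (w : {set 'I_s} -> 'rV[S]_(rank F i)) :
  (forall a : 'I_(rank F (i + p)), shift a <> j) ->
  (forall W : {set 'I_s}, #|W| <> p -> w W = 0) ->
  (forall W a m, m \in msupp (w W 0 a) -> (#|W| + mdeg m + shift a)%N = j) ->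
  (forall W, exists u, boundary (fun x => 'X_x) w W = u *m dif F i) ->
  exists v' v, forall W, w W = boundary (fun x => 'X_x) v' W + v W *m dif F i.
Proof.
elim: p i w => [|p IHp] i w noj wp wdeg wdif.
  (* Here [w] lives on the empty set alone, so it is a Koszul cycle; a constant term would need a
     generator of degree [j]. *)
  have [||v' v'E] := @koszul_exact_row K s _ w.
  - move=> W; rewrite /boundary big1 // => x xW.
    by rewrite wp ?scaler0 // cardsU1 xW.
  - move=> a; apply/eqP; rewrite mcoeff_eq0; apply/negP => /wdeg.
    rewrite cards0 mdeg0 /=; move: noj; rewrite addn0; exact.
  by exists v', (fun=> 0) => W; rewrite v'E mul0mx addr0.
have bdeg W a m : m \in msupp (boundary (fun x => 'X_x) w W 0 a) ->
    (#|W| + mdeg m + shift a)%N = j.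
  move=> /boundary_msupp[x [m' [xW /wdeg]]] + ->.
  by rewrite cardsU1 xW mdegD mdeg1 addnCA addnA.
have bp (W : {set 'I_s}) : #|W| <> p -> boundary (fun x => 'X_x) w W = 0.
  move=> cW; rewrite /boundary big1 // => x xW.
  by rewrite wp ?scaler0 // cardsU1 xW => -[].
(* The connecting homomorphism: lift the boundary of [w] through [dif F i], keeping the grading and
   the support on sets of size [p]. *)
have [u uP] : exists u : {set 'I_s} -> 'rV[S]_(rank F i.+1), forall W : {set 'I_s},
    [/\ #|W| <> p -> u W = 0, boundary (fun x => 'X_x) w W = u W *m dif F i
      & forall a m, m \in msupp (u W 0 a) -> (#|W| + mdeg m + shift a)%N = j].
  apply: (@fin_all_exists _ (fun=> 'rV[S]_(rank F i.+1))
    (fun (W : {set 'I_s}) (z : 'rV[S]_(rank F i.+1)) => [/\ #|W| <> p -> z = 0,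
      boundary (fun x => 'X_x) w W = z *m dif F i
      & forall a m, m \in msupp (z 0 a) -> (#|W| + mdeg m + shift a)%N = j])) => W.
  have [cW | /eqP cW] := eqVneq #|W| p.
    have [z0 zE] := wdif W; have [z zE' zdeg] := graded_lift zE (bdeg W).
    by exists z; split.
  by exists 0; split=> // [|a m]; rewrite ?mul0mx ?bp // mxE msupp0.
have [||||v [y uE]] := IHp i.+1 u.
- by move: noj; rewrite addnS -addSn.
- by move=> W; have [] := uP W.
- by move=> W; have [] := uP W.
(* By exactness it suffices that [dif F i] kills the boundary of [u]; its image there is the double
   boundary of [w]. *)
- move=> W; apply/(res_exact resF); rewrite -boundary_mulmx.
  rewrite -[RHS](boundaryK (fun x => 'X_x) w W).
  by apply: eq_boundary => U; have [] := uP U.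
have dif2 : dif F i.+1 *m dif F i = 0.
  apply/row_matrixP => a; rewrite row_mul row0.
  by apply/(res_exact resF); exists (delta_mx 0 a); rewrite -rowE.
(* The correction by [v] turns [w] into a Koszul cycle of the free module $F_i$. Its constant term
   on the empty set vanishes because [w] is supported in size [p.+1] and the resolution is
   minimal. *)
have [||v' v'E] := @koszul_exact_row K s _ (fun W => w W - v W *m dif F i).
- move=> W; rewrite boundaryD boundaryN boundary_mulmx.
  by have [_ -> _] := uP W; rewrite uE mulmxDl -mulmxA dif2 mulmx0 addr0 subrr.
- move=> a; rewrite wp ?cards0 // sub0r mxE mcoeffN.
  apply/eqP; rewrite oppr_eq0; apply: contraT.
  move=> /mcoeff_mulmx[b [m1 [m2 [_ m2P /esym/eqP]]]].
  rewrite mnmD_eq0 => /andP[_ /eqP m20].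
  by move: m2P; rewrite m20 mcoeff_msupp (res_minimal resF) eqxx.
by exists v', v => W; rewrite v'E subrK.
Qed.
End Resolution.

(** * The ideal of circuits *)

Section CircuitIdeal.
Variables (K : fieldType) (s : nat) (M : matroid 'I_s).
Local Notation S := {mpoly K[s]}.
Local Notation I := (circuit_ideal K M).
Implicit Types (A B U : {set 'I_s}) (f g : S).

Lemma sqfree_monomialE A : sqfree_monomial K A = 'X_[mind A].
Proof.
rewrite /sqfree_monomial mprodXE; congr 'X_[_]; apply/mnmP=> i.
rewrite mnm_sumE mindE; case: (boolP (i \in A)) => iA.
  rewrite (bigD1 i) //= big1 ?mnm1E ?eqxx // => k /andP[_ nki].
  by rewrite mnm1E (negPf nki).
by rewrite big1 // => k kA; rewrite mnm1E; case: eqP iA => // <-; rewrite kA.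
Qed.

Lemma msetD (m1 m2 : 'X_{1..s}) : mset (m1 + m2)%MM = mset m1 :|: mset m2.
Proof. by apply/setP=> i; rewrite !inE mnmDE addn_eq0 negb_and. Qed.

(** The Stanley-Reisner description: every dependent support contains a circuit, whose squarefree
    monomial then divides the given one. *)
Lemma circuit_idealP f : I f <-> forall m, m \in msupp f -> mset m \notin indep M.
Proof.
split=> [[c ->] m /msupp_sum_le/flattenP[_ /mapP[e + ->]] | depf].
  rewrite mem_filter inE => /andP[/minsetP[de _] _].
  rewrite sqfree_monomialE => /msuppM_le/allpairsP[[m1 m2] /= [_ + ->]].
  rewrite msuppX inE => /eqP->; rewrite msetD mset_mind.
  by apply: contra de; apply: indepS; apply: subsetUr.
rewrite [f]mpolyE big_seq; elim/big_ind: _ => [|f1 f2 [c1 ->] [c2 ->]|m mf].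
- by exists (fun=> 0); rewrite big1 // => e _; rewrite mul0r.
- exists (fun e => c1 e + c2 e); rewrite -big_split.
  by apply: eq_bigr => e _; rewrite mulrDl.
have [e mine se] := @minset_exists _ (fun A => A \notin indep M) _ (depf m mf).
exists (fun e' => if e' == e then f@_m *: 'X_[m - mind e] else 0).
rewrite (bigD1 e) ?inE //= eqxx big1 => [|e' /andP[_ /negPf->]]; last by rewrite mul0r.
by rewrite addr0 sqfree_monomialE -scalerAl -mpolyXD submK ?mind_le.
Qed.

Lemma restriction_eq0 U g :
  g \mPo [tuple if i \in U then 'X_i else 0 | i < s] = 0 <->
  forall m, m \in msupp g -> ~~ (mset m \subset U).
Proof.
pose lq : s.-tuple S := [tuple if i \in U then 'X_i else 0 | i < s].
have lqX m : 'X_[m] \mPo lq = if mset m \subset U then 'X_[m] else 0.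
  rewrite comp_mpolyX; case: ifP => [/subsetP sU | /negbT/subsetPn[i]].
    rewrite mpolyXE_id; apply: eq_bigr => i _; rewrite tnth_mktuple.
    case: ifP => // /negbT iU; have [-> // | mi] := eqVneq (m i) 0%N.
    by case/negP: iU; apply: sU; rewrite inE.
  rewrite inE => mi iU; rewrite (bigD1 i) //= tnth_mktuple (negPf iU).
  by rewrite expr0n (negPf mi) mul0r.
rewrite comp_mpolyEX -/lq; split=> [g0 m mg | dg]; last first.
  by rewrite big_seq big1 // => m /dg/negPf mU; rewrite lqX mU scaler0.
apply/negP => mU; move: (mg); rewrite mcoeff_msupp => /eqP; apply.
rewrite -[RHS](mcoeff0 _ m) -[X in _ = X@__]g0 (bigD1_seq m) //= mcoeffD lqX mU.
rewrite mcoeffZ mcoeffX eqxx mulr1 raddf_sum big1 ?addr0 //= => m' nm'.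
rewrite mcoeffZ lqX; case: ifP => _; last by rewrite mcoeff0 mulr0.
by rewrite mcoeffX (negPf nm') mulr0.
Qed.

(** The colon ideal is the kernel of the substitution killing the variables outside [U], a ring
    endomorphism of the domain [S]. *)
Lemma colon_prime A U : A \subset U -> U \in indep M ->
  (forall x, x \notin U -> x |: A \notin indep M) ->
  is_prime (colon I (sqfree_monomial K A)).
Proof.
move=> sAU iU dA.
pose lq : s.-tuple S := [tuple if i \in U then 'X_i else 0 | i < s].
have colonE g : colon I (sqfree_monomial K A) g <-> g \mPo lq = 0.
  rewrite restriction_eq0 /colon circuit_idealP sqfree_monomialE.
  split=> dg m mg.
    have : mset (m + mind A)%MM \notin indep M.
      by apply: dg; rewrite (perm_mem (msuppMX _ _)) addmC map_f.
    apply: contra => mU; apply: indepS iU.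
    by rewrite msetD mset_mind subUset mU.
  move: mg; rewrite (perm_mem (msuppMX _ _)) => /mapP[m' /dg/subsetPn[x xm xU] ->].
  rewrite msetD mset_mind; apply: contra (dA x xU); apply: indepS.
  by rewrite setUC setUS // sub1set.
split; first split.
- by apply/colonE; rewrite comp_mpoly0.
- by move=> f g /colonE f0 /colonE g0; apply/colonE; rewrite comp_mpolyD f0 g0 addr0.
- by move=> g f /colonE f0; apply/colonE; rewrite rmorphM /= f0 mulr0.
- by move/colonE; rewrite comp_mpoly1 => /eqP; rewrite oner_eq0.
- move=> f g /colonE; rewrite rmorphM /= => /eqP; rewrite mulf_eq0.
  by case/orP=> /eqP ?; [left | right]; apply/colonE.
Qed.

(** Supplies the hypotheses of [colon_prime] with [U] equal to [A :|: coloops M]: a basis of [M]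
    above [A] contains every coloop, and an independent [x |: A] with [x] no coloop would contradict
    maximality. *)
Lemma base_del_coloops A : base (deletion M (coloops M)) A ->
  [/\ [disjoint A & coloops M], A :|: coloops M \in indep M &
      forall x, x \notin A :|: coloops M -> x |: A \notin indep M].
Proof.
case/baseP; rewrite in_deletion => /andP[iA dA] maxA; split=> // [|x].
  have [D bD sAD] := base_extend iA; have /baseP[iD _] := bD.
  apply: indepS iD; rewrite subUset sAD; apply/subsetP => x /coloopsP; exact.
rewrite inE negb_or => /andP[xA xL]; apply/negP => ixA.
have := maxA (x |: A); rewrite in_deletion ixA cardsU1 xA add1n ltnn => H; apply: (notF (H _)).
by rewrite -setI_eq0 setIUl setU_eq0 !setI_eq0 disjoints1 xL.
Qed.

End CircuitIdeal.

(** * Duality between a Koszul strand and simplicial chains *)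

Section Duality.
Variables (K : fieldType) (s : nat) (G : {set 'I_s}).
Local Notation S := {mpoly K[s]}.
Implicit Types (A W : {set 'I_s}).

(** For [A] inside [G] this is, up to a sign depending only on [#|A|], the sign of the shuffle
    listing [A] before [G :\: A]. *)
Definition compl_sign A : K :=
  \prod_(a in A) (-1) ^+ #|[set g in G | (g < a)%N]|.

Lemma compl_sign_neq0 A : compl_sign A != 0.
Proof. by rewrite prodf_seq_neq0; apply/allP => a _; rewrite signr_eq0 implybT. Qed.

(** The elements of [G] below [x] split into those in [A] and those in [G :\: (x |: A)], and the
    signs multiply accordingly. *)
Lemma compl_signU1 x A : x \notin A -> x |: A \subset G ->
  compl_sign (x |: A) * sgn K x (G :\: (x |: A)) = compl_sign A * sgn K x A.
Proof.
move=> xA sG; rewrite /compl_sign big_setU1 //= [_ * \prod_(i in A) _]mulrC -mulrA.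
congr (_ * _); rewrite -[in LHS](cardsID A).
have -> : [set g in G | (g < x)%N] :&: A = [set y in A | (y < x)%N].
  apply/setP=> y; rewrite !inE andbAC.
  case: (boolP (y \in A)) => yA; last by rewrite andbF.
  by rewrite (subsetP sG) // !inE yA orbT.
have -> : [set g in G | (g < x)%N] :\: A = [set y in G :\: (x |: A) | (y < x)%N].
  apply/setP=> y; rewrite !inE; case: (y =P x) => [-> | _] /=.
    by rewrite ltnn !andbF.
  by rewrite andbA.
by rewrite exprD -mulrA -expr2 sqrr_sign mulr1.
Qed.

(* Complementation in [G] identifies the strand of multidegree [mind G] of the
   Koszul complex of a Stanley-Reisner ring with simplicial cochains; a
   simplicial cycle [phi] is thus a functional vanishing on boundaries. *)
Lemma cycle_boundary_pairing (phi : {set 'I_s} -> K^o) (v : {set 'I_s} -> S^o) :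
  (forall A, phi A != 0 -> A \subset G) ->
  (forall W, boundary (fun=> 1) phi W = 0) ->
  \sum_A compl_sign A * phi A *
    (boundary (fun x => 'X_x) v (G :\: A))@_(mind A) = 0.
Proof.
move=> sphi dphi.
transitivity (\sum_(A : {set 'I_s}) \sum_(x in A) compl_sign A * phi A *
    (sgn K x (G :\: A) * (v (G :\: (A :\ x)))@_(mind (A :\ x)))).
  apply: eq_bigr => A _; have [-> | /sphi sA] := eqVneq (phi A) 0.
    by rewrite mulr0 mul0r big1 // => x _; rewrite mul0r.
  rewrite mcoeff_boundary mulr_sumr [RHS]big_mkcond [LHS]big_mkcond.
  apply: eq_bigr => x _; rewrite mindE eqb0 negbK !inE.
  case: (boolP (x \in A)) => xA; last by rewrite mulr0 if_same.
  congr (_ * (_ * (v _)@__)).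
    by rewrite -{1}(setD1K xA) mindU1 ?inE ?eqxx // addmC addmK.
  apply/setP=> y; rewrite !inE; case: (y =P x) => //= ->.
  by rewrite (subsetP sA).
rewrite (exchange_big_dep predT) //=.
(* Renaming [A :\ x] to [A] moves the boundary from [v] to [phi]; the sum over [x] then becomes the
   boundary of [phi] at [A]. *)
transitivity (\sum_x \sum_(A : {set 'I_s} | x \notin A) compl_sign A *
    (sgn K x A * phi (x |: A)) * (v (G :\: A))@_(mind A)).
  apply: eq_bigr => x _.
  rewrite (reindex_onto (fun A => x |: A) (fun A => A :\ x)) => [|A];
    last exact: setD1K.
  apply: eq_big => [A | A /andP[_ /eqP defA]].
    rewrite !inE eqxx /=; apply/eqP/idP => [<- | xA]; last exact: setU1K.
    by rewrite !inE eqxx.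
  have xA : x \notin A by rewrite -defA !inE eqxx.
  have [-> | /sphi sA] := eqVneq (phi (x |: A)) 0; first by rewrite !(mulr0, mul0r).
  by rewrite defA mulrA [_ * phi _ * _]mulrAC compl_signU1 // !mulrA.
rewrite (exchange_big_dep predT) //= big1 // => A _.
rewrite -mulr_suml -mulr_sumr (_ : \sum_(x | _) _ = 0) ?mulr0 ?mul0r //.
by rewrite -[RHS](dphi A); apply: eq_bigr => x _; rewrite mul1r.
Qed.

End Duality.

Theorem corollary3p14 (K : fieldType) (s : nat) (M : matroid 'I_s)
    (v : nat) (r : int) :
  is_vnumber (circuit_ideal K M) v ->
  is_regularity (circuit_ideal K M) r ->
  v%:Z <= r.
Proof.
move=> [_ minv] [F [resF [_ maxr]]].
have [phi [[B phiB] bphi dphi]] :=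
  coloop_free_top_cycle K (coloop_free_del_coloops M).
pose G := ~: coloops M.
have sphi A : phi A != 0 -> A \subset G.
  by move=> /bphi/base_del_coloops[dA _ _]; rewrite /G -disjoints_subset.
have [dB iBL maxB] := base_del_coloops (bphi B phiB).
have sBG := sphi B phiB.
have le_vB : (v <= #|B|)%N.
  apply: minv; exists (sqfree_monomial K B); split.
    by rewrite sqfree_monomialE dhomogX /= mdeg_mind.
  exists (colon (circuit_ideal K M) (sqfree_monomial K B)); split=> //; split.
    by apply: colon_prime maxB; rewrite ?subsetUl.
  by exists (sqfree_monomial K B).
pose p := #|G :\: B|.
have cG : (#|B| + p)%N = #|G| by rewrite -(cardsID B G) (setIidPr sBG).
(* A generator of degree [#|G|] in $F_p$ gives the bound, since [#|G| - p] is [#|B|]. Without one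
   the Koszul class would be trivial, which the pairing with [phi] refutes. *)
have [/existsP[a aG] | noa] := boolP [exists a : 'I_(rank F p), shift a == #|G|].
  have le_r : #|G|%:Z - p%:Z <= r.
    apply: maxr; apply/eqP; rewrite -lt0n /betti card_gt0.
    by apply/set0Pn; exists a; rewrite inE.
  by apply: le_trans le_r; rewrite -cG PoszD addrK lez_nat.
pose w (W : {set 'I_s}) : 'rV[{mpoly K[s]}]_(rank F 0) :=
    if W == G :\: B then const_mx 'X_[mind B] else 0.
have Iw m : m \in msupp ('X_[mind B] : {mpoly K[s]}) -> m = mind B.
  by rewrite msuppX inE => /eqP.
have [||||v1 [v0 wE]] := koszul_class_trivial (j := #|G|) (p := p) resF (w := w).
- by move=> a aG; move: noa; rewrite negb_exists => /forallP/(_ a)/eqP; apply.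
- by move=> W cW; rewrite /w; case: eqP cW => // ->.
- move=> W a m; rewrite /w; case: eqP => [-> | _]; rewrite mxE ?msupp0 //.
  by move=> /Iw->; rewrite mdeg_mind (res_shift0 resF) addn0 addnC.
(* The boundary of [w] only involves $t_x t_B$ with [x] in [G :\: B], and [x |: B] is dependent. *)
- move=> W; apply/(res_exact0 resF) => b; apply/circuit_idealP => m.
  move=> /boundary_msupp[x [m' [xW + ->]]]; rewrite /w.
  case: eqP => [defW | _]; rewrite mxE ?msupp0 // => /Iw->.
  have xGB : x \in G :\: B by rewrite -defW setU11.
  rewrite -mindU1 ?mset_mind; first apply: maxB; move: xGB; rewrite !inE.
    by rewrite negb_or.
  by case/andP.
have b0 : 'I_(rank F 0) by rewrite (res_rank0 resF); exact: ord0.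
have : \sum_A compl_sign K G A * phi A * (w (G :\: A) 0 b0)@_(mind A) = 0.
  transitivity (\sum_A compl_sign K G A * phi A *
     (boundary (fun x => 'X_x) (fun U => v1 U 0 b0 : {mpoly K[s]}^o)
       (G :\: A))@_(mind A)).
    apply: eq_bigr => A _; have [-> | nzA] := eqVneq (phi A) 0.
      by rewrite !mulr0 !mul0r.
    rewrite wE mxE mcoeffD; congr (_ * _).
    have Iv0 : circuit_ideal K M ((v0 (G :\: A) *m dif F 0) 0 b0).
      by apply: (res_exact0 resF _).2; exists (v0 (G :\: A)).
    (* The set [A] is independent, so its monomial occurs in no element of the ideal. *)
    have -> : ((v0 (G :\: A) *m dif F 0) 0 b0)@_(mind A) = 0.
      apply/eqP; rewrite mcoeff_eq0; apply/negP.
      move=> /((circuit_idealP _ _).1 Iv0); rewrite mset_mind => /negP; apply.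
      by have /baseP[] := bphi A nzA; rewrite in_deletion => /andP[].
    by rewrite addr0 boundary_entry.
  exact: cycle_boundary_pairing.
(* Only [A = B] contributes to the pairing, and its term is a sign times [phi B], which is
   nonzero. *)
rewrite (bigD1 B) //= big1 => [|A nAB].
  rewrite addr0 /w eqxx mxE mcoeffX eqxx mulr1 => /eqP.
  by rewrite mulf_eq0 (negPf (compl_sign_neq0 _ _ _)) (negPf phiB).
have [-> | /sphi sAG] := eqVneq (phi A) 0; first by rewrite !mulr0 mul0r.
rewrite /w; case: eqP => _; rewrite mxE ?mcoeff0 ?mulr0 // mcoeffX.
case: eqP => [eqBA | _]; last by rewrite mulr0.
by case/eqP: nAB; rewrite -(mset_mind A) -eqBA mset_mind.
Qed.
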